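(* Let $\beta>0$ and let $m,n\to+\infty$ with $m/n\to\beta$. Let $Z$ be a non-negative integer-valued random variable such that $\mathbf{E} Z<\infty$ and $\mathbf{E} Z^2=\infty$, and let $\mathrm{P}$ denote the distribution of $\min\{Z,m\}$. Then the global clustering coefficient of the active random intersection graph $G=G(n,m,\mathrm{P})$ satisfies $C_G=o_P(1)$.
   Context: Active random intersection graph $G(n,m,\mathrm{P})$: the vertex set is $V=\{v_1,\dots,v_n\}$ and there is an auxiliary attribute set $W=\{w_1,\dots,w_m\}$. Each vertex $v\in V$ independently selects a random subset $S_v\subset W$ with $\mathbf{P}(S_v=A)=\mathrm{P}(|A|)\binom{m}{|A|}^{-1}$ for $A\subset W$, where $\mathrm{P}$ is a probability distribution on $\{0,1,\dots,m\}$ (so given $|S_v|$, $S_v$ is uniform among subsets of that size). Two distinct vertices $u,v$ are adjacent in $G$ iff $S_u\cap S_v\neq\emptyset$. For a graph $G$, the global clustering coefficient is $C_G=3\Delta/\Lambda$, where $\Delta$ is the number of triangles and $\Lambda$ is the number of paths of length $2$ in $G$. $o_P(1)$ denotes a quantity converging to $0$ in probability as $m,n\to\infty$. *)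

(* Defs.v *)
From HB Require Import structures.
From mathcomp Require Import all_boot all_order all_algebra.
From mathcomp Require Import all_classical all_reals all_analysis.
Set Implicit Arguments. Unset Strict Implicit. Unset Printing Implicit Defensive.
Import Order.TTheory GRing.Theory Num.Theory.
Local Open Scope ring_scope.

(* A configuration of G(n,m,P): each vertex v : 'I_n picks S v \subset W = 'I_m. *)
Definition config (n m : nat) := {ffun 'I_n -> {set 'I_m}}.

(* The distribution P of min{Z, m}, where Z has pmf p (with total mass 1):
   P(k) = p k for k < m,  P(m) = P(Z >= m) = 1 - sum_{i<m} p i,  P(k) = 0 for k > m. *)
Definition Pmin {R : realType} (p : nat -> R) (m k : nat) : R :=
  if (k < m)%N then p k
  else if k == m then 1 - \sum_(i < m) p i else 0.

(* Probability of a configuration: independent vertices,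
   P(S_v = A) = P(|A|) / binom(m, |A|). *)
Definition config_prob {R : realType} (p : nat -> R) (n m : nat) (S : config n m) : R :=
  \prod_(v < n) (Pmin p m #|S v| / ('C(m, #|S v|))%:R).

Definition adj (n m : nat) (S : config n m) (u v : 'I_n) : bool :=
  (u != v) && (S u :&: S v != finset.set0).

Definition n_triangles (n m : nat) (S : config n m) : nat :=
  #|[set T : {set 'I_n} | (#|T| == 3)%N &&
        [forall u in T, forall v in T, (u != v) ==> adj S u v]]|.

Definition degree (n m : nat) (S : config n m) (v : 'I_n) : nat :=
  #|[set u | adj S v u]|.

(* number of paths of length 2 (unordered, counted by their middle vertex) *)
Definition n_paths2 (n m : nat) (S : config n m) : nat :=
  (\sum_(v < n) 'C(degree S v, 2))%N.

(* global clustering coefficient 3 Delta / Lambda (equal to 0 when Lambda = 0,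
   by MathComp's convention x / 0 = 0) *)
Definition clustering {R : realType} (n m : nat) (S : config n m) : R :=
  3 * (n_triangles S)%:R / (n_paths2 S)%:R.

Definition prob_clust_gt {R : realType} (p : nat -> R) (n m : nat) (eps : R) : R :=
  \sum_(S : config n m | (clustering S : R) > eps) config_prob p S.

(* Main.v *)
Require Import Defs.
From HB Require Import structures.
From mathcomp Require Import all_boot all_order all_algebra.
From mathcomp Require Import all_classical all_reals all_analysis.
From mathcomp Require Import ring lra.
Import Order.TTheory GRing.Theory Num.Theory.
Import numFieldNormedType.Exports.

(* Condition on the sizes x_v = |S_v| and fix a large threshold T; put Q = sum of x_v^2 over
   x_v > T. The expected number of paths u - v - w is at most x_u x_v^2 x_w / m^2. A triangle
   with a vertex of size at most T is a path centred there, and there are O(T n) such paths in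
   expectation; the triangles with all sizes above T number at most Q (sum_{x_u > T} x_u)^2 / m^2
   in expectation, a small fraction of Q because E Z is finite. On the other hand, for k >= 1
   with P(Z = k) > 0, the vertices of size k alone give a vertex with x_v > T of order x_v
   neighbours, up to a failure probability O(1 / T) by Chebyshev; Markov's inequality for the
   x_v^2-weighted failures then bounds the number of 2-paths below by a constant times Q. Finally
   Q / n tends to infinity in probability because E Z^2 is infinite. Only Q itself appears in
   the comparison: the sum of x_v^2 need not concentrate around its mean. *)

Local Open Scope ring_scope.

(** * Expectation over independent coordinates, with Markov and Chebyshev bounds *)

Definition prodE {R : realType} {I T : finType} (w : I -> T -> R)
    (F : {ffun I -> T} -> R) : R :=
  \sum_(S : {ffun I -> T}) (\prod_i w i (S i)) * F S.

Definition upd {I T : finType} (S : {ffun I -> T}) (i : I) (t : T) : {ffun I -> T} :=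
  [ffun j => if j == i then t else S j].

Section ProductMeasure.
Context {R : realType} {I T : finType}.
Variable w : I -> T -> R.
Hypothesis w_ge0 : forall i t, 0 <= w i t.
Hypothesis w_sum1 : forall i, \sum_t w i t = 1.
Implicit Types (F G : {ffun I -> T} -> R) (S : {ffun I -> T}).

Lemma upd_same S i t : upd S i t i = t.
Proof. by rewrite ffunE eqxx. Qed.

Lemma upd_neq S i j t : j != i -> upd S i t j = S j.
Proof. by move=> /negbTE ji; rewrite ffunE ji. Qed.

Lemma prod_w_ge0 S : 0 <= \prod_i w i (S i).
Proof. by apply: prodr_ge0 => i _. Qed.

Lemma eq_prodE F G : F =1 G -> prodE w F = prodE w G.
Proof. by move=> FG; apply: eq_bigr => S _; rewrite FG. Qed.

Lemma prodE_cst a : prodE w (fun=> a) = a.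
Proof.
rewrite /prodE -mulr_suml -(bigA_distr_bigA w).
by rewrite (eq_bigr (fun=> 1)) ?big1_eq ?mul1r // => i _; apply: w_sum1.
Qed.

Lemma prodEZ a F : prodE w (fun S => a * F S) = a * prodE w F.
Proof. by rewrite /prodE mulr_sumr; apply: eq_bigr => S _; rewrite mulrCA. Qed.

Lemma prodED F G : prodE w (fun S => F S + G S) = prodE w F + prodE w G.
Proof. by rewrite /prodE -big_split; apply: eq_bigr => S _; rewrite mulrDr. Qed.

Lemma prodE_sum (J : finType) (P : pred J) (F : J -> {ffun I -> T} -> R) :
  prodE w (fun S => \sum_(j | P j) F j S) = \sum_(j | P j) prodE w (F j).
Proof.
rewrite /prodE exchange_big /=; apply: eq_bigr => S _.
by rewrite mulr_sumr.
Qed.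

(** Comparing only on configurations of nonzero weight lets almost sure facts, such as
    [#|S v| = x v], enter the comparison. *)
Lemma ler_prodE F G :
  (forall S, \prod_i w i (S i) != 0 -> F S <= G S) -> prodE w F <= prodE w G.
Proof.
move=> FG; apply: ler_sum => S _.
have [->|nz] := eqVneq (\prod_i w i (S i)) 0; first by rewrite !mul0r.
by apply: ler_wpM2l; [exact: prod_w_ge0|exact: FG].
Qed.

(* (S, t) |-> (S[i := t], S i) is an involution preserving the weight of (S, t). *)
Lemma prodE_resample i F :
  prodE w F = prodE w (fun S => \sum_t w i t * F (upd S i t)).
Proof.
pose h (St : {ffun I -> T} * T) := (upd St.1 i St.2, St.1 i).
have hK : involutive h.
  case=> S t; rewrite /h /= upd_same; congr pair.
  by apply/ffunP => j; rewrite !ffunE; case: eqP => [->|].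
transitivity (\sum_(St : {ffun I -> T} * T)
    (\prod_j w j (St.1 j)) * (w i St.2 * F St.1)).
  rewrite -(pair_bigA _ (fun S t => (\prod_j w j (S j)) * (w i t * F S))) /=.
  apply: eq_bigr => S _.
  by rewrite -mulr_sumr -mulr_suml w_sum1 mul1r.
rewrite (reindex_inj (inv_inj hK)) /prodE.
under [RHS]eq_bigr do rewrite mulr_sumr.
rewrite [RHS]pair_bigA /=; apply: eq_bigr => -[S t] _ /=.
rewrite !mulrA; congr (_ * _).
rewrite (bigD1 i) //= upd_same [in RHS](bigD1 i) //=.
rewrite (eq_bigr (fun j => w j (S j))) => [|j ji]; last by rewrite upd_neq.
by rewrite mulrAC [w i t * _]mulrC mulrAC mulrC mulrA.
Qed.

Lemma prodE_coord i (f : T -> R) : prodE w (fun S => f (S i)) = \sum_t w i t * f t.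
Proof.
rewrite (prodE_resample i) -[RHS]prodE_cst; apply: eq_prodE => S.
by apply: eq_bigr => t _; rewrite upd_same.
Qed.

(** After expanding the square, an off-diagonal term vanishes: resampling coordinate [j] with the
    others fixed averages [g j] to 0. *)
Lemma prodE_sqr_sum (U : pred I) (g : I -> T -> R) :
  (forall i, \sum_t w i t * g i t = 0) ->
  prodE w (fun S => (\sum_(i | U i) g i (S i)) ^+ 2) =
  \sum_(i | U i) \sum_t w i t * g i t ^+ 2.
Proof.
move=> g0.
under eq_prodE do rewrite expr2 mulr_suml.
rewrite prodE_sum; apply: eq_bigr => i Ui.
under eq_prodE do rewrite mulr_sumr.
rewrite prodE_sum (bigD1 i) //= big1 ?addr0 => [|j /andP[_ ji]].
  by rewrite -prodE_coord; apply: eq_prodE => S; rewrite expr2.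
rewrite (prodE_resample j) -[RHS](prodE_cst 0); apply: eq_prodE => S.
under eq_bigr => t _ do rewrite upd_same upd_neq 1?eq_sym // mulrCA.
by rewrite -mulr_sumr g0 mulr0.
Qed.

Lemma prodE_markov F (a : R) : (forall S, 0 <= F S) -> 0 < a ->
  prodE w (fun S => (a < F S)%R%:R) <= prodE w F / a.
Proof.
move=> F0 a0; rewrite mulrC -prodEZ; apply: ler_prodE => S _.
rewrite mulrC; case: ltP => aF; last by rewrite divr_ge0 // ltW.
by rewrite ler_pdivlMr // mul1r ltW.
Qed.

(** As 0 <= f <= L, each variance is at most L times the mean, so the sum has variance at most L mu.
    Falling below a <= mu / 2 is a deviation of at least mu / 2, and 4 L / mu <= 2 L / a. *)
Lemma prodE_chebyshev (U : pred I) (f : I -> T -> R) (L a : R) :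
  (forall i t, 0 <= f i t <= L) -> 0 < a ->
  2 * a <= \sum_(i | U i) \sum_t w i t * f i t ->
  prodE w (fun S => (\sum_(i | U i) f i (S i) < a)%R%:R) <= 2 * L / a.
Proof.
move=> fL a0; set mu := \sum_(i | U i) _ => amu.
have mu0 : 0 < mu by apply: lt_le_trans amu; rewrite mulr_gt0.
pose g i t := f i t - \sum_t w i t * f i t.
have g0 i : \sum_t w i t * g i t = 0.
  under eq_bigr do rewrite mulrBr.
  by rewrite sumrB -mulr_suml w_sum1 mul1r subrr.
have var_le : \sum_(i | U i) \sum_t w i t * g i t ^+ 2 <= L * mu.
  rewrite mulr_sumr; apply: ler_sum => i _.
  apply: (@le_trans _ _ (\sum_t w i t * f i t ^+ 2)).
    set e := \sum_t w i t * f i t.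
    have -> : \sum_t w i t * g i t ^+ 2 = \sum_t w i t * f i t ^+ 2 - e ^+ 2.
      transitivity (\sum_t (w i t * f i t ^+ 2 - 2 * e * (w i t * f i t) + e ^+ 2 * w i t)).
        by apply: eq_bigr => t _; rewrite /g -/e; ring.
      by rewrite big_split sumrB /= -!mulr_sumr w_sum1 -/e; ring.
    by rewrite gerBl sqr_ge0.
  rewrite mulr_sumr; apply: ler_sum => t _; have /andP[f0 fle] := fL i t.
  by rewrite expr2 mulrCA ler_wpM2r // mulr_ge0.
have mu2 : 0 < mu / 2 by rewrite divr_gt0.
apply: (@le_trans _ _ (prodE w (fun S => (mu / 2) ^- 2 * (\sum_(i | U i) g i (S i)) ^+ 2))).
  apply: ler_prodE => S _; rewrite /g sumrB -/mu.
  case: ltP => lta /=; last by rewrite mulr_ge0 ?invr_ge0 ?sqr_ge0.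
  rewrite mulrC ler_pdivlMr ?exprn_gt0 // mul1r -[X in _ <= X]sqrrN opprB.
  rewrite ler_pXn2r ?nnegrE //; first by lra.
    exact: ltW.
  by lra.
rewrite prodEZ prodE_sqr_sum // mulrC ler_pdivrMr ?exprn_gt0 //.
apply: le_trans var_le _.
have L0 : 0 <= L.
  rewrite leNgt; apply/negP => L0; move: mu0; rewrite /mu big1 ?ltxx // => i _.
  by rewrite big1 // => t _; have := fL i t; lra.
have -> : 2 * L / a * (mu / 2) ^+ 2 = L * mu * (mu / 2 / a) by field; rewrite gt_eqF.
by rewrite ler_peMr ?mulr_ge0 ?(ltW mu0) // ler_pdivlMr // mul1r; lra.
Qed.

End ProductMeasure.

(** * Uniform random subsets of a given size *)

Definition meet {m : nat} (A B : {set 'I_m}) : bool := A :&: B != finset.set0.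

(** The law of a uniform k-subset, put on all subsets so that vertices of different sizes share one
    sample type. *)
Definition unif_weight {R : realType} (m k : nat) (A : {set 'I_m}) : R :=
  (#|A| == k)%:R / 'C(m, k)%:R.

Section UniformSubset.
Context {R : realType}.
Variables m k : nat.
Hypothesis k_le_m : (k <= m)%N.
Local Notation w := (@unif_weight R m k).

Lemma unif_weight_ge0 A : 0 <= w A.
Proof. by rewrite divr_ge0. Qed.

Lemma unif_weight_sum1 : \sum_A w A = 1.
Proof.
rewrite -mulr_suml -natr_sum.
have -> : (\sum_(A : {set 'I_m}) (#|A| == k) = 'C(m, k))%N.
  rewrite -[X in 'C(X, _)]card_ord -card_draws -sum1dep_card [RHS]big_mkcond.
  by apply: eq_bigr => A _; rewrite ?inE; case: (_ == k).
by rewrite divff // pnatr_eq0 -lt0n bin_gt0.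
Qed.

(** The k-subsets that avoid [a] are the k-subsets of its complement. *)
Lemma card_draws_mem (a : 'I_m) :
  (#|[set A : {set 'I_m} | (#|A| == k) && (a \in A)]%SET| + 'C(m.-1, k) = 'C(m, k))%N.
Proof.
rewrite -[X in _ = 'C(X, _)]card_ord -card_draws addnC.
rewrite -[RHS](cardsID [set A : {set 'I_m} | A \subset ~: [set a]]%SET).
have <- : #|(~: [set a])%SET| = m.-1 by rewrite cardsC1 card_ord.
rewrite -cards_draws; congr (_ + _)%N; apply: eq_card => A; rewrite !inE; first exact: andbC.
by rewrite finset.subsetC finset.sub1set inE negbK andbC.
Qed.

Lemma unif_weight_mem (a : 'I_m) : \sum_A w A * (a \in A)%:R = k%:R / m%:R.
Proof.
have m0 : (0 < m)%N by case: a => [a]; apply: leq_trans.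
have -> : \sum_A w A * (a \in A)%:R =
    #|[set A : {set 'I_m} | (#|A| == k) && (a \in A)]%SET|%:R / 'C(m, k)%:R.
  rewrite -sum1dep_card natr_sum mulr_suml [RHS]big_mkcond; apply: eq_bigr => A _.
  rewrite /unif_weight mulrAC -natrM mulnb.
  by case: (_ && _); rewrite ?mul0r.
have C0 : 'C(m, k)%:R != 0 :> R by rewrite pnatr_eq0 -lt0n bin_gt0.
apply/eqP; rewrite eqr_div // ?pnatr_eq0 -?lt0n // -!natrM eqr_nat; apply/eqP.
(* For k > 0, Pascal's rule makes the count C(m-1, k-1), and m C(m-1, k-1) = k C(m, k). *)
have := card_draws_mem a; case: (k) => [|k'].
  by rewrite !bin0 mul0n => /eqP; rewrite -[X in _ == X]add0n eqn_add2r => /eqP ->.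
case: (m) => [|m'] in a m0 *; first by case: a.
by rewrite binS /= [RHS]addnC => /addIn ->; rewrite -binS mulnC mul_bin_diag.
Qed.

Lemma unif_weight_card_meet (B : {set 'I_m}) :
  \sum_A w A * #|A :&: B|%:R = k%:R * #|B|%:R / m%:R.
Proof.
under eq_bigr => A _.
  rewrite -sum1_card natr_sum big_mkcond /= mulr_sumr.
  over.
rewrite exchange_big /= -mulrA mulrCA -sum1_card natr_sum mulr_suml [RHS]big_mkcond /=.
apply: eq_bigr => a _; case: ifP => aB.
  rewrite mul1r -(unif_weight_mem a); apply: eq_bigr => A _.
  by rewrite finset.in_setI aB andbT; case: ifP.
by rewrite big1 // => A _; rewrite finset.in_setI aB andbF mulr0.
Qed.

Lemma unif_weight_meet_le (B : {set 'I_m}) :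
  \sum_A w A * (meet A B)%:R <= k%:R * #|B|%:R / m%:R.
Proof.
rewrite -unif_weight_card_meet; apply: ler_sum => A _.
by rewrite ler_wpM2l ?unif_weight_ge0 // ler_nat /meet -card_gt0; case: #|_|.
Qed.

(** A k-subset meets [B] in at most k points, so the indicator is at least |A :&: B| / k. *)
Lemma unif_weight_meet_ge (B : {set 'I_m}) : (0 < k)%N ->
  #|B|%:R / m%:R <= \sum_A w A * (meet A B)%:R.
Proof.
move=> k0; have kR : 0 < k%:R :> R by rewrite ltr0n.
rewrite -(ler_pM2l kR) mulrA -unif_weight_card_meet mulr_sumr.
apply: ler_sum => A _; rewrite mulrCA /unif_weight.
case: eqP => [Ak|]; last by rewrite !mul0r.
rewrite ler_wpM2l ?divr_ge0 // -natrM ler_nat /meet -card_gt0.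
by case: posnP => [->|_] //; rewrite muln1 -Ak subset_leq_card // finset.subsetIl.
Qed.

End UniformSubset.

(** * The random graph with prescribed sizes *)

Section FixedSizes.
Context {R : realType}.
Variables n m : nat.
Variable x : 'I_n -> nat.
Hypothesis x_le_m : forall v, (x v <= m)%N.
Implicit Types (u v : 'I_n) (S : config n m).
Local Notation w := (fun v => @unif_weight R m (x v)).
Local Notation E := (@prodE R 'I_n {set 'I_m} w).

Let w_ge0 v A : 0 <= w v A.
Proof. exact: unif_weight_ge0. Qed.

Let w_sum1 v : \sum_A w v A = 1.
Proof. exact: unif_weight_sum1. Qed.

Lemma support_card S v : \prod_u w u (S u) != 0 -> #|S v| = x v.
Proof.
move=> /prodf_neq0 /(_ v isT); rewrite /unif_weight.
by case: (#|S v| =P x v) => // _; rewrite mul0r eqxx.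
Qed.

Lemma meetC (A B : {set 'I_m}) : meet A B = meet B A.
Proof. by rewrite /meet finset.setIC. Qed.

(** Given [S v] the two adjacencies are independent: [u] and then [t] is resampled with [S v] fixed,
    and [unif_weight_meet_le] bounds each factor. *)
Lemma path_prob_le u v t : u != v -> t != v -> u != t ->
  E (fun S => (adj S v u && adj S v t)%:R) <=
  (x v)%:R ^+ 2 * (x u)%:R * (x t)%:R / m%:R ^+ 2.
Proof.
move=> uv tv ut.
have [vu vt tu] : [/\ v != u, v != t & t != u] by rewrite ![v == _]eq_sym [t == u]eq_sym.
rewrite (prodE_resample _ w_sum1 u).
apply: (@le_trans _ _ (E (fun S =>
    ((x u)%:R * #|S v|%:R / m%:R) * (meet (S t) (S v))%:R))).
  apply: ler_prodE => // S _.
  apply: le_trans (ler_wpM2r (ler0n _ _) (unif_weight_meet_le _ _ (x_le_m u) (S v))).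
  rewrite mulr_suml; apply: ler_sum => A _.
  rewrite -[leRHS]mulrA ler_wpM2l // -natrM ler_nat /adj -!/(meet _ _).
  rewrite upd_same (upd_neq _ _ _ _ vu) (upd_neq _ _ _ _ tu) vu vt /=.
  by rewrite [meet (S v) A]meetC [meet (S v) (S t)]meetC mulnb.
rewrite (prodE_resample _ w_sum1 t).
apply: (@le_trans _ _ (E (fun S =>
    ((x u)%:R * #|S v|%:R / m%:R) * ((x t)%:R * #|S v|%:R / m%:R)))).
  apply: ler_prodE => // S _.
  apply: le_trans (ler_wpM2l _ (unif_weight_meet_le _ _ (x_le_m t) (S v))); last first.
    by rewrite divr_ge0 // mulr_ge0.
  rewrite mulr_sumr; apply: ler_sum => A _.
  by rewrite upd_same (upd_neq _ _ _ _ vt) mulrCA.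
rewrite -[leRHS](prodE_cst w w_sum1); apply: ler_prodE => // S /support_card ->.
rewrite le_eqVlt; apply/orP; left; apply/eqP.
by rewrite -exprVn; ring.
Qed.

(* The first vertex is the middle of a 2-path covering the triangle; it is chosen of size
   at most T if the triangle has such a vertex. *)
Definition path_triples (T : nat) : {set 'I_n * 'I_n * 'I_n} :=
  [set q | [&& q.1.2 != q.1.1, q.2 != q.1.1, q.1.2 != q.2 &
    (x q.1.1 <= T)%N || [&& T < x q.1.1, T < x q.1.2 & T < x q.2]%N]]%SET.

(** Every triangle is the vertex set, under [h], of a counted triple, and an image is no larger than
    its source. *)
Lemma n_triangles_le (T : nat) S :
  (n_triangles S <= \sum_(q in path_triples T) (adj S q.1.1 q.1.2 && adj S q.1.1 q.2))%N.
Proof.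
rewrite (eq_bigr (fun q => if adj S q.1.1 q.1.2 && adj S q.1.1 q.2 then 1 else 0)%N); last first.
  by move=> q _; case: (_ && _).
rewrite -big_mkcondr /= sum1dep_card.
set D := [set _ | _]%SET.
pose h (q : 'I_n * 'I_n * 'I_n) := [set q.1.1; q.1.2; q.2]%SET.
apply: leq_trans (leq_imset_card h D).
apply/subset_leq_card/fintype.subsetP => A; rewrite inE => /andP[/eqP A3 /'forall_implyP adjA].
have [] := @card_gt2P _ (mem A) _; first by rewrite A3.
move=> a [b [c [[aA bA cA] [ab bc ca]]]].
have adjP u v : u \in A -> v \in A -> u != v -> adj S u v.
  by move=> uA vA uv; have /'forall_implyP/(_ v vA)/implyP := adjA u uA; apply.
have hP u v t : u \in A -> v \in A -> t \in A -> u != v -> v != t -> t != u ->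
    (x u <= T)%N || [&& T < x u, T < x v & T < x t]%N -> A \in h @: D.
  move=> uA vA tA uv vt tu xT; apply/imsetP; exists (u, v, t).
    by rewrite !inE /= (eq_sym v u) uv tu vt xT !adjP // eq_sym.
  apply/esym/eqP; rewrite eqEcard A3 /h /=; apply/andP; split.
    by apply/fintype.subsetP => z; rewrite !inE => /orP[/orP[]|] /eqP ->.
  by rewrite finset.setUC cardsU1 cards2 !inE uv negb_or tu eq_sym vt.
have [xa|xa] := leqP (x a) T; first by apply: (hP a b c) => //; rewrite xa.
have [xb|xb] := leqP (x b) T; first by apply: (hP b c a) => //; rewrite xb.
have [xc|xc] := leqP (x c) T; first by apply: (hP c a b) => //; rewrite xc.
by apply: (hP a b c) => //; rewrite xa xb xc orbT.
Qed.

Let sum_triple (f g h : 'I_n -> R) :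
  \sum_(q : 'I_n * 'I_n * 'I_n) f q.1.1 * g q.1.2 * h q.2 =
  (\sum_v f v) * (\sum_v g v) * (\sum_v h v).
Proof.
rewrite -(pair_bigA _ (fun (q : 'I_n * 'I_n) t => f q.1 * g q.2 * h t)) /=.
under eq_bigr do rewrite -mulr_sumr.
rewrite -mulr_suml; congr (_ * _).
rewrite -(pair_bigA _ (fun u v => f u * g v)) /=.
by under eq_bigr do rewrite -mulr_sumr; rewrite -mulr_suml.
Qed.

Definition total_size : R := \sum_v (x v)%:R.
Definition large_sum (T : nat) : R := \sum_(v | (T < x v)%N) (x v)%:R.
Definition large_sqr_sum (T : nat) : R := \sum_(v | (T < x v)%N) (x v)%:R ^+ 2.

(** Without the distinctness conditions, the sum of the bounds from [path_prob_le] factors into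
    three sums over vertices. For a centre of size at most T, x_v^2 <= T x_v gives the first term;
    three large vertices give the second. *)
Lemma mean_triangles_le (T : nat) :
  E (fun S => (n_triangles S)%:R) <=
  (T%:R * total_size ^+ 3 + large_sqr_sum T * large_sum T ^+ 2) / m%:R ^+ 2.
Proof.
apply: (@le_trans _ _ (E (fun S => \sum_(q in path_triples T)
    (adj S q.1.1 q.1.2 && adj S q.1.1 q.2)%:R))).
  by apply: ler_prodE => // S _; rewrite -natr_sum ler_nat n_triangles_le.
rewrite prodE_sum.
pose B f (P : pred 'I_n) := fun v => if P v then f v else 0 : R.
pose lg := [pred v | (T < x v)%N]; pose sm := [pred v | (x v <= T)%N].
pose X v : R := (x v)%:R; pose Y v : R := (x v)%:R ^+ 2.
apply: (@le_trans _ _ (\sum_(q : 'I_n * 'I_n * 'I_n)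
   (B Y sm q.1.1 * X q.1.2 * X q.2 + B Y lg q.1.1 * B X lg q.1.2 * B X lg q.2) / m%:R ^+ 2)).
  rewrite big_mkcond /=; apply: ler_sum => -[[v u] t] _ /=.
  rewrite inE /= /B /= /X /Y; case: ifP; last first.
    by move=> _; do 4?case: ifP => _; rewrite ?mul0r ?mulr0 ?addr0 ?add0r ?divr_ge0 ?addr_ge0 ?mulr_ge0.
  move=> /and4P[uv tv ut xT]; apply: le_trans (path_prob_le _ _ _ uv tv ut) _.
  rewrite ler_wpM2r ?invr_ge0 ?exprn_ge0 //.
  have [xv|xv] := leqP (x v) T; first by rewrite !mul0r addr0.
  by move: xT; rewrite leqNgt xv /= => /andP[-> ->]; rewrite !mul0r add0r.
rewrite -mulr_suml ler_wpM2r ?invr_ge0 ?exprn_ge0 // big_split /= !sum_triple.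
rewrite /B -!big_mkcond /= -/(large_sum T) -/(large_sqr_sum T) -/total_size.
rewrite -[X in X + _]mulrA -[X in _ + X <= _]mulrA -!expr2 lerD2r.
rewrite [_ ^+ 3]exprS mulrA ler_wpM2r ?exprn_ge0 ?sumr_ge0 //.
rewrite big_mkcond /= mulr_sumr; apply: ler_sum => v _; case: leqP => xv.
  by rewrite /Y expr2 ler_wpM2r // ler_nat.
by rewrite mulr_ge0.
Qed.

(* Given S v, the neighbours of v of size k are counted by independent indicators. *)
Lemma degree_small_prob_le (k : nat) v (a : R) : (0 < k)%N -> 0 < a ->
  2 * a <= #|[set u | (u != v) && (x u == k)]%SET|%:R * (x v)%:R / m%:R ->
  E (fun S => ((degree S v)%:R < a)%R%:R) <= 2 / a.
Proof.
move=> k0 a0 aN.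
pose U := [pred u | (u != v) && (x u == k)].
apply: (@le_trans _ _ (E (fun S =>
    (\sum_(u | U u) (meet (S u) (S v))%:R < a)%R%:R))).
  apply: ler_prodE => // S _; rewrite ler_nat.
  case: ltP => //= da; rewrite lt0b; apply: le_lt_trans da.
  rewrite -natr_sum ler_nat /degree -sum1dep_card [leqRHS]big_mkcond [leqLHS]big_mkcond /=.
  apply: leq_sum => u _; case: ifP => // /andP[uv _].
  by rewrite /adj eq_sym uv /= finset.setIC -/(meet _ _); case: meet.
rewrite (prodE_resample _ w_sum1 v).
apply: (@le_trans _ _ (E (fun S => \sum_B w v B *
    (\sum_(u | U u) (meet (S u) B)%:R < a)%R%:R))).
  apply: ler_prodE => // S _; apply: ler_sum => B _; rewrite ler_wpM2l // ler_nat upd_same.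
  rewrite (eq_bigr (fun u => (meet (S u) B)%:R)) // => u /andP[uv _].
  by rewrite (upd_neq _ _ _ _ uv).
rewrite prodE_sum.
apply: (@le_trans _ _ (\sum_B w v B * (2 / a))); last first.
  by rewrite -mulr_suml w_sum1 mul1r.
apply: ler_sum => B _; rewrite prodEZ.
(* Sets of zero weight drop out; the others have size [x v], so that [aN] bounds the mean from
   below. *)
have [B0|B0] := eqVneq (w v B) 0; first by rewrite B0 !mul0r.
rewrite ler_wpM2l //.
have cB : #|B| = x v.
  by move: B0; rewrite /unif_weight; case: (#|B| =P x v) => // _; rewrite mul0r eqxx.
have -> : 2 / a = 2 * 1 / a by rewrite mulr1.
apply: (prodE_chebyshev w w_ge0 w_sum1 U (fun _ A => (meet A B)%:R)) => //.
  by move=> i A; case: meet; rewrite /= ?ler01 ?lexx.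
apply: (le_trans aN).
rewrite -sum1dep_card natr_sum -mulrA mulr_suml /=.
apply: ler_sum => u /andP[_ /eqP uk]; rewrite mul1r -cB.
by apply: unif_weight_meet_ge => //; rewrite uk.
Qed.

(** Since d >= a >= 2, also d - 1 >= a / 2, so d (d - 1) / 2 >= a^2 / 4. *)
Lemma bin2_ge (d : nat) (a : R) : 2 <= a -> a <= d%:R -> a ^+ 2 / 4 <= 'C(d, 2)%:R.
Proof.
move=> a2 ad; have d0 : (0 < d)%N by rewrite -(ltr0n R); lra.
have : (2 * 'C(d, 2))%:R = d%:R * (d%:R - 1) :> R.
  by rewrite -mul_bin_diag bin1 natrM; congr (_ * _); rewrite -[in RHS](prednK d0) -natr1 addrK.
rewrite natrM => dE.
have : a * (a / 2) <= d%:R * (d%:R - 1) by apply: ler_pM; lra.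
lra.
Qed.

(** Markov's inequality bounds the probability of two events: [bad] above Q / 2, and more than eps
    c^2 Q / 24 triangles. Outside them there are at least c^2 Q / 8 paths, and 24 = 3 * 8 makes the
    coefficient at most eps. *)
Lemma clustering_prob_le (T k : nat) (c eps : R) :
  (0 < k)%N -> 0 < c -> 0 < eps -> 2 <= c * T%:R ->
  2 * c * m%:R + 1 <= #|[set u | x u == k]%SET|%:R ->
  0 < large_sqr_sum T ->
  E (fun S => (eps < clustering S)%R%:R) <=
  4 / (c * T%:R) +
  24 / (eps * c ^+ 2 * large_sqr_sum T) *
  ((T%:R * total_size ^+ 3 + large_sqr_sum T * large_sum T ^+ 2) / m%:R ^+ 2).
Proof.
move=> k0 c0 eps0 cT NU; set Q := large_sqr_sum T => Q0.
have T0 : 0 < T%:R :> R by rewrite -(pmulr_rgt0 _ c0); lra.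
(* The weight x_v^2 makes [bad] exactly the part of Q lost to large vertices of low degree. *)
pose bad S : R := \sum_(v | (T < x v)%N) (x v)%:R ^+ 2 * ((degree S v)%:R < c * (x v)%:R)%R%:R.
have bad_ge0 S : 0 <= bad S by apply: sumr_ge0 => v _; rewrite mulr_ge0 ?exprn_ge0.
have Ebad : E bad <= Q * (2 / (c * T%:R)).
  rewrite prodE_sum /Q /large_sqr_sum mulr_suml; apply: ler_sum => v Tv.
  have xv0 : 0 < (x v)%:R :> R by rewrite ltr0n; apply: leq_trans Tv.
  have m0 : 0 < m%:R :> R by rewrite ltr0n; apply: leq_trans (x_le_m v); apply: leq_trans Tv.
  rewrite prodEZ ler_wpM2l ?exprn_ge0 //.
  apply: (@le_trans _ _ (2 / (c * (x v)%:R))); last first.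
    by rewrite ler_pM2l // lef_pV2 ?posrE ?mulr_gt0 // ler_pM2l // ler_nat ltnW.
  apply: (degree_small_prob_le k); rewrite ?mulr_gt0 //.
  rewrite ler_pdivlMr // [leLHS](_ : _ = 2 * c * m%:R * (x v)%:R); last by ring.
  (* The extra 1 in the assumption pays for [v] itself, which may have size k. *)
  rewrite ler_pM2r //; apply: le_trans (_ : #|[set u | x u == k]%SET|%:R - 1 <= _).
    by lra.
  rewrite lerBlDr natr1 ler_nat (cardsD1 v) -add1n leq_add ?leq_b1 //.
  by apply/subset_leq_card/fintype.subsetP => u; rewrite !inE.
(* A large vertex of degree at least c x_v >= c T >= 2 centres at least (c x_v)^2 / 4 paths. *)
have paths_ge S : bad S <= Q / 2 -> c ^+ 2 * Q / 8 <= (n_paths2 S)%:R.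
  move=> badQ.
  apply: (@le_trans _ _ (c ^+ 2 / 4 * (Q - bad S))).
    have : 0 < c ^+ 2 by rewrite exprn_gt0.
    by move: (c ^+ 2) => cc cc0; nra.
  rewrite /n_paths2 natr_sum /Q /large_sqr_sum /bad -sumrB mulr_sumr big_mkcond.
  apply: ler_sum => v _; case: ifP => // Tv.
  case: ltP => dv; first by rewrite mulr1 subrr mulr0.
  rewrite mulr0 subr0 mulrAC -exprMn; apply: bin2_ge => //.
  by apply: (le_trans cT); rewrite ler_pM2l // ler_nat ltnW.
have ec0 : 0 < eps * c ^+ 2 * Q by rewrite !mulr_gt0 ?exprn_gt0.
apply: (@le_trans _ _ (E (fun S => (Q / 2 < bad S)%R%:R +
    (eps * c ^+ 2 * Q / 24 < (n_triangles S)%:R)%R%:R))).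
  apply: ler_prodE => // S _.
  rewrite -natrD ler_nat; have [_|badQ] := ltP (Q / 2) (bad S); first by case: (eps < _).
  rewrite add0n; case: ltP => //= ltC; rewrite lt0b.
  have := paths_ge S badQ; move: ltC; rewrite /clustering.
  move: (n_triangles S)%:R (n_paths2 S)%:R => D L ltC L_ge.
  have L0 : 0 < L by apply: lt_le_trans L_ge; rewrite divr_gt0 ?mulr_gt0 ?exprn_gt0.
  move: ltC; rewrite ltr_pdivlMr // => ltC.
  have : eps * (c ^+ 2 * Q / 8) <= eps * L by rewrite ler_pM2l.
  by move: ltC; rewrite -!mulrA; lra.
rewrite prodED; apply: lerD.
  apply: (le_trans (prodE_markov _ w_ge0 _ _ bad_ge0 (divr_gt0 Q0 (ltr0Sn _ 1)))).
  rewrite ler_pdivrMr ?divr_gt0 //; apply: (le_trans Ebad).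
  by rewrite le_eqVlt; apply/orP; left; apply/eqP; field; rewrite !gt_eqF.
apply: (le_trans (prodE_markov _ w_ge0 _ _ _ _)) => //; first by rewrite divr_gt0.
rewrite mulrC invf_div ler_wpM2l //; first by rewrite divr_ge0 // ltW.
exact: mean_triangles_le.
Qed.

End FixedSizes.

(** * The sizes as independent copies of min{Z, m} *)

Lemma sum_config_prob {R : realType} (p : nat -> R) (n m : nat) (F : config n m -> R) :
  \sum_(S : config n m) config_prob p S * F S =
  prodE (fun (_ : 'I_n) (k : 'I_m.+1) => Pmin p m k)
    (fun X => prodE (fun v => @unif_weight R m (X v)) F).
Proof.
rewrite /prodE.
under [RHS]eq_bigr do rewrite mulr_sumr.
rewrite exchange_big /=; apply: eq_bigr => S _.
under [RHS]eq_bigr do rewrite mulrA -big_split /=.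
rewrite -mulr_suml; congr (_ * _).
(* Distributivity turns the sum over size vectors into a product over vertices, whose factor at [v]
   collapses to k = |S v|. *)
rewrite -(bigA_distr_bigA (fun v (k : 'I_m.+1) => Pmin p m k * unif_weight m k (S v))).
apply: eq_bigr => v _.
have Sm : (#|S v| < m.+1)%N by rewrite ltnS -[leqRHS]card_ord max_card.
rewrite (bigD1 (Ordinal Sm)) //= /unif_weight eqxx mul1r big1 ?addr0 // => k kS.
case: eqP => [e|]; last by rewrite mul0r mulr0.
by case/eqP: kS; apply: val_inj; rewrite /= e.
Qed.

Lemma sum_ord_cat {R : realType} (u : nat -> R) (m N : nat) : (m <= N)%N ->
  \sum_(k < N) u k = \sum_(k < m) u k + \sum_(m <= k < N) u k.
Proof. by move=> mN; rewrite -!(big_mkord xpredT u) (big_cat_nat _ mN). Qed.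

Local Open Scope classical_set_scope.
Local Open Scope ring_scope.

Section Sizes.
Context {R : realType}.
Variables (p : nat -> R) (mu : R).
Hypothesis p_ge0 : forall k, 0 <= p k.
Hypothesis p_sum1 : (fun N => \sum_(k < N) p k) @ \oo --> (1 : R).
Hypothesis mean_p : (fun N => \sum_(k < N) (k%:R * p k)) @ \oo --> mu.

Let kp_ge0 k : 0 <= k%:R * p k.
Proof. exact: mulr_ge0. Qed.

Lemma partial_sum_nondecreasing (u : nat -> R) :
  (forall k, 0 <= u k) -> nondecreasing_seq (fun N => \sum_(k < N) u k).
Proof.
move=> u0; apply/nondecreasing_seqP => N.
by rewrite big_ord_recr /= lerDl.
Qed.

Lemma partial_sum_le (u : nat -> R) (l : R) (N : nat) : (forall k, 0 <= u k) ->
  (fun N => \sum_(k < N) u k) @ \oo --> l -> \sum_(k < N) u k <= l.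
Proof.
move=> u0 ul; rewrite -(cvg_lim _ ul) //.
apply: nondecreasing_cvgn_le; first exact: partial_sum_nondecreasing.
by apply/cvg_ex; exists l.
Qed.

(** This is m P(Z >= m) <= E[Z; Z >= m], proved on partial sums and passed to the limit. *)
Lemma top_mass_le (m : nat) :
  m%:R * (1 - \sum_(k < m) p k) <= mu - \sum_(k < m) (k%:R * p k).
Proof.
have cv : (fun N => m%:R * (\sum_(k < N) p k - \sum_(k < m) p k)) @ \oo -->
    m%:R * (1 - \sum_(k < m) p k).
  by apply: cvgMr; apply: cvgB => //; apply: cvg_cst.
apply: (cvgr_to_le cv); exists m => // N /= mN.
rewrite lerBrDr; apply: le_trans (partial_sum_le _ _ N kp_ge0 mean_p).
rewrite (sum_ord_cat p _ _ mN) (sum_ord_cat (fun k => k%:R * p k) _ _ mN).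
rewrite [X in X - _]addrC addrK addrC lerD2l mulr_sumr.
rewrite big_nat [leRHS]big_nat.
by apply: ler_sum => k /andP[mk _]; rewrite ler_wpM2r // ler_nat.
Qed.

Lemma Pmin_ge0 (m k : nat) : 0 <= Pmin p m k.
Proof.
rewrite /Pmin; case: ifP => // _; case: ifP => // _.
by rewrite subr_ge0; apply: partial_sum_le.
Qed.

Lemma Pmin_sum (m : nat) (f : nat -> R) :
  \sum_(k < m.+1) Pmin p m k * f k =
  \sum_(k < m) p k * f k + (1 - \sum_(k < m) p k) * f m.
Proof.
rewrite big_ord_recr /= {2}/Pmin ltnn eqxx; congr (_ + _).
by apply: eq_bigr => k _; rewrite /Pmin ltn_ord.
Qed.

Lemma Pmin_sum1 (m : nat) : \sum_(k < m.+1) Pmin p m k = 1.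
Proof.
rewrite -[RHS](subrK (\sum_(k < m) p k)) addrC -[X in _ + X]mulr1.
have := Pmin_sum m (fun=> 1); under eq_bigr do rewrite mulr1; move=> ->.
by congr (_ + _); apply: eq_bigr => k _; rewrite mulr1.
Qed.

(** A function vanishing above L < m does not see the truncation at m, so its mean does not depend
    on m. *)
Lemma Pmin_sum_small (m L : nat) (f : nat -> R) : (L < m)%N ->
  (forall k, (L < k)%N -> f k = 0) ->
  \sum_(k < m.+1) Pmin p m k * f k = \sum_(k < L.+1) p k * f k.
Proof.
move=> Lm f0; rewrite Pmin_sum f0 // mulr0 addr0.
rewrite (sum_ord_cat (fun k => p k * f k) _ _ Lm).
rewrite [X in _ + X]big_nat [X in _ + X]big1 ?addr0 // => k /andP[Lk _].
by rewrite f0 // mulr0.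
Qed.

(** Truncation only lowers the tail mean, the atom at m being absorbed by [top_mass_le]. The bound
    is uniform in m. *)
Lemma Pmin_tail_le (m T : nat) : (T < m)%N ->
  \sum_(k < m.+1) Pmin p m k * (k%:R * (T < k)%N%:R) <= mu - \sum_(k < T.+1) (k%:R * p k).
Proof.
move=> Tm; rewrite (Pmin_sum m (fun k => k%:R * (T < k)%N%:R)) Tm mulr1.
rewrite lerBrDr; apply: (@le_trans _ _ (\sum_(k < m) (k%:R * p k) + m%:R * (1 - \sum_(k < m) p k))).
  rewrite addrAC [X in _ <= _ + X]mulrC lerD2r.
  rewrite (sum_ord_cat (fun k => k%:R * p k) _ _ Tm).
  rewrite (sum_ord_cat (fun k => p k * (k%:R * (T < k)%N%:R)) _ _ Tm) big1 ?add0r => [|k _]; last first.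
    by rewrite ltnNge -ltnS ltn_ord !mulr0.
  rewrite addrC lerD2l.
  rewrite big_nat [leRHS]big_nat; apply: ler_sum => k /andP[-> _].
  by rewrite mulr1 mulrC.
by rewrite -lerBrDl; apply: top_mass_le.
Qed.

Local Notation sizeE n m := (@prodE R 'I_n 'I_m.+1 (fun _ k => Pmin p m k)).
Local Notation sizes X := (fun v => nat_of_ord (X v)).

Lemma mean_large_sum_le (n m T : nat) : (T < m)%N ->
  sizeE n m (fun X => large_sum n (sizes X) T) <=
  n%:R * (mu - \sum_(k < T.+1) (k%:R * p k)).
Proof.
move=> Tm.
have w_ge0 (i : 'I_n) (k : 'I_m.+1) : 0 <= Pmin p m k by apply: Pmin_ge0.
have w_sum1 (i : 'I_n) : \sum_(k < m.+1) Pmin p m k = 1 by apply: Pmin_sum1.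
have -> : sizeE n m (fun X => large_sum n (sizes X) T) =
    sizeE n m (fun X => \sum_v (X v)%:R * (T < X v)%N%:R).
  apply: eq_prodE => X; rewrite /large_sum big_mkcond; apply: eq_bigr => v _.
  by case: ifP; rewrite ?mulr1 ?mulr0.
rewrite prodE_sum.
under eq_bigr do rewrite (prodE_coord _ w_sum1 _ (fun k : 'I_m.+1 => k%:R * (T < k)%N%:R)).
by rewrite sumr_const card_ord -[leLHS]mulr_natl ler_wpM2l //; apply: Pmin_tail_le.
Qed.

(** Brings the total size under the mean bound for large sums, at threshold 0. *)
Lemma total_size_large_sum (n : nat) (x : 'I_n -> nat) :
  total_size n x = large_sum n x 0 :> R.
Proof.
rewrite /total_size /large_sum [RHS]big_mkcond; apply: eq_bigr => v _.
by case: ltnP => //; rewrite leqn0 => /eqP ->.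
Qed.

Lemma sizes_chebyshev (n m L : nat) (f : nat -> R) (B a : R) : (L < m)%N ->
  (forall k, 0 <= f k <= B) -> (forall k, (L < k)%N -> f k = 0) -> 0 < a ->
  2 * a <= n%:R * \sum_(k < L.+1) p k * f k ->
  sizeE n m (fun X => (\sum_v f (X v) < a)%R%:R) <= 2 * B / a.
Proof.
move=> Lm fB f0 a0 aE.
apply: (prodE_chebyshev _ _ _ xpredT (fun _ (k : 'I_m.+1) => f k)) => //.
- by move=> _ k; apply: Pmin_ge0.
- by move=> _; apply: Pmin_sum1.
- apply: (le_trans aE).
  under [leRHS]eq_bigr do rewrite (Pmin_sum_small _ _ _ Lm f0).
  by rewrite sumr_const card_ord -[leRHS]mulr_natl.
Qed.

(** The first four terms bound the probability of atypical sizes: total above C n, large part above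
    eta n, too few vertices of size k, squares below M n. For all other sizes [clustering_prob_le]
    gives the last term. *)
Lemma prob_clust_gt_le (n m T k L : nat) (b c eps C eta M : R) :
  0 < c -> 0 < eps -> 0 < C -> 0 < eta -> 0 < M -> (0 < n)%N -> (0 < k)%N ->
  (T < m)%N -> (k < m)%N -> (L < m)%N -> 2 <= c * T%:R ->
  n%:R <= b * m%:R -> 2 * (2 * c * m%:R + 1) <= n%:R * p k ->
  2 * M <= \sum_(i < L.+1) p i * (i%:R ^+ 2 * (T < i)%N%:R) ->
  prob_clust_gt p n m eps <=
    mu / C + (mu - \sum_(i < T.+1) (i%:R * p i)) / eta +
    2 / (2 * c * m%:R + 1) + 2 * L%:R ^+ 2 / (M * n%:R) +
    (4 / (c * T%:R) + 24 / (eps * c ^+ 2) * (b ^+ 2 * (T%:R * C ^+ 3 / M + eta ^+ 2))).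
Proof.
move=> c0 eps0 C0 eta0 M0 n0 k0 Tm km Lm cT nb pk ML.
have T0 : 0 < T%:R :> R by rewrite -(pmulr_rgt0 _ c0); lra.
move bdE : (4 / _ + _) => bd.
have w_ge0 (i : 'I_n) (j : 'I_m.+1) : 0 <= Pmin p m j by apply: Pmin_ge0.
have w_sum1 (i : 'I_n) : \sum_(j < m.+1) Pmin p m j = 1 by apply: Pmin_sum1.
have m0 : 0 < m%:R :> R by rewrite ltr0n; apply: leq_trans Tm.
have n0R : 0 < n%:R :> R by rewrite ltr0n.
have b0 : 0 < b by rewrite -(pmulr_lgt0 _ m0); apply: lt_le_trans nb.
pose few (X : {ffun 'I_n -> 'I_m.+1}) : R := \sum_v (nat_of_ord (X v) == k)%:R.
(* The cutoff at L keeps the summands bounded, as Chebyshev's inequality requires, and still bounds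
   Q from below. *)
pose sqr (X : {ffun 'I_n -> 'I_m.+1}) : R :=
  \sum_v ((X v)%:R ^+ 2 * ((T < X v) && (X v <= L))%N%:R).
have -> : prob_clust_gt p n m eps = sizeE n m (fun X =>
    prodE (fun v => @unif_weight R m (X v)) (fun S => (eps < clustering S)%R%:R)).
  rewrite -sum_config_prob /prob_clust_gt big_mkcond; apply: eq_bigr => S _.
  by case: ifP; rewrite ?mulr1 ?mulr0.
apply: (@le_trans _ _ (sizeE n m (fun X =>
    (C * n%:R < large_sum n (sizes X) 0)%R%:R +
    (eta * n%:R < large_sum n (sizes X) T)%R%:R +
    (few X < 2 * c * m%:R + 1)%R%:R + (sqr X < M * n%:R)%R%:R + bd))); last first.
  have large_ge0 (j : nat) (X : {ffun 'I_n -> 'I_m.+1}) : 0 <= large_sum n (sizes X) j :> R by apply: sumr_ge0.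
  rewrite !prodED (prodE_cst _ w_sum1) lerD2r; apply: lerD; [apply: lerD; [apply: lerD|]|].
  - apply: (le_trans (prodE_markov _ w_ge0 _ _ (large_ge0 0%N) (mulr_gt0 C0 n0R))).
    rewrite ler_pdivrMr ?mulr_gt0 //; apply: (le_trans (mean_large_sum_le _ _ _ (leq_trans _ Tm))) => //.
    by rewrite big_ord1 mul0r subr0 mulrA divfK ?gt_eqF // mulrC.
  - apply: (le_trans (prodE_markov _ w_ge0 _ _ (large_ge0 T) (mulr_gt0 eta0 n0R))).
    rewrite ler_pdivrMr ?mulr_gt0 //; apply: (le_trans (mean_large_sum_le _ _ _ Tm)).
    by rewrite mulrA divfK ?gt_eqF // mulrC.
  - rewrite -[X in X / _](mulr1 2).
    apply: (sizes_chebyshev _ _ k (fun j => (j == k)%:R)) => //.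
    + by move=> j; case: eqP; rewrite ?lexx ?ler01.
    + by move=> j kj; rewrite gtn_eqF.
    + by rewrite ltr_wpDl // !mulr_ge0 // ltW.
    + apply: (le_trans pk); rewrite big_ord_recr /= eqxx mulr1 ler_wpM2l // lerDr.
      by apply: sumr_ge0 => i _; rewrite mulr_ge0.
  - apply: (sizes_chebyshev _ _ L (fun j => j%:R ^+ 2 * ((T < j) && (j <= L))%N%:R)) => //.
    + move=> j; case: (_ < _)%N; rewrite /= ?mulr0 ?lexx ?exprn_ge0 //.
      case: leqP => jL; rewrite ?mulr0 ?mulr1 ?lexx exprn_ge0 //=.
      by rewrite ler_pXn2r ?nnegrE // ler_nat.
    + by move=> j Lj; rewrite [(j <= L)%N]leqNgt Lj andbF mulr0.
    + exact: mulr_gt0.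
    + rewrite mulrA [leLHS]mulrC ler_wpM2l //; apply: (le_trans ML); apply: ler_sum => j _.
      by rewrite -[(j <= L)%N]ltnS ltn_ord andbT.
apply: ler_prodE => // X _.
set F := (X in prodE _ X <= _).
have F1 : prodE (fun v => @unif_weight R m (X v)) F <= 1.
  have u1 (v : 'I_n) : \sum_(A : {set 'I_m}) unif_weight m (X v) A = 1 :> R.
    by apply: unif_weight_sum1; rewrite -ltnS ltn_ord.
  rewrite -[leRHS](prodE_cst _ u1); apply: ler_prodE => [v A|S _]; first exact: unif_weight_ge0.
  by rewrite /F; case: (_ < _).
have bd0 : 0 <= bd.
  by rewrite -bdE !(addr_ge0, mulr_ge0, exprn_ge0, invr_ge0) // ltW.
case: ltP => [_|sC]; first by apply: (le_trans F1); rewrite -!addrA lerDl !addr_ge0.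
case: ltP => [_|tC]; first by apply: (le_trans F1); rewrite ?add0r -!addrA lerDl !addr_ge0.
case: ltP => [_|fewX]; first by apply: (le_trans F1); rewrite !add0r -!addrA lerDl !addr_ge0.
case: ltP => [_|sqrX]; first by apply: (le_trans F1); rewrite !add0r lerDl.
rewrite !add0r.
have Q_ge : M * n%:R <= large_sqr_sum n (sizes X) T.
  apply: (le_trans sqrX); rewrite /large_sqr_sum [leRHS]big_mkcond; apply: ler_sum => v _.
  by case: (_ < _)%N; case: (_ <= _)%N; rewrite /= ?mulr0 ?mulr1 // exprn_ge0.
have Q0 : 0 < large_sqr_sum n (sizes X) T :> R by apply: lt_le_trans Q_ge; apply: mulr_gt0.
have XM v : (X v <= m)%N by rewrite -ltnS ltn_ord.
apply: (le_trans (clustering_prob_le _ _ _ XM _ k _ _ k0 c0 eps0 cT _ Q0)).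
  apply: (le_trans fewX); rewrite -sum1dep_card natr_sum [leRHS]big_mkcond /=.
  by apply: ler_sum => v _; case: (_ == k).
rewrite -bdE lerD2l total_size_large_sum; move: Q_ge Q0 sC tC.
have s0 : 0 <= large_sum n (sizes X) 0 :> R by apply: sumr_ge0.
have t0 : 0 <= large_sum n (sizes X) T :> R by apply: sumr_ge0.
move: (large_sqr_sum _ _ _) (large_sum _ _ 0) (large_sum _ _ T) s0 t0 => Q s t s0 t0 QM Q0 sC tC.
(* Q cancels in the all-large term and elsewhere only divides, so the lower bound M n on Q
   suffices. *)
have -> : 24 / (eps * c ^+ 2 * Q) * ((T%:R * s ^+ 3 + Q * t ^+ 2) / m%:R ^+ 2) =
    24 / (eps * c ^+ 2) * ((T%:R * (s ^+ 3 / Q) + t ^+ 2) / m%:R ^+ 2).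
  by field; rewrite !gt_eqF.
rewrite ler_wpM2l ?divr_ge0 ?mulr_ge0 ?exprn_ge0 ?(ltW eps0) ?(ltW c0) //.
rewrite ler_pdivrMr ?exprn_gt0 // [leRHS]mulrAC -exprMn.
have n2 : n%:R ^+ 2 <= (b * m%:R) ^+ 2 by rewrite ler_pXn2r ?nnegrE // mulr_ge0 // ltW.
apply: (@le_trans _ _ (n%:R ^+ 2 * (T%:R * C ^+ 3 / M + eta ^+ 2))); last first.
  by rewrite ler_wpM2r // addr_ge0 ?divr_ge0 ?mulr_ge0 ?exprn_ge0 // ltW.
rewrite mulrDr lerD //; last first.
  by rewrite -exprMn mulrC ler_pXn2r ?nnegrE // mulr_ge0 // ltW.
have -> : n%:R ^+ 2 * (T%:R * C ^+ 3 / M) = T%:R * ((C * n%:R) ^+ 3 / (M * n%:R)).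
  by field; rewrite !gt_eqF.
rewrite ler_wpM2l // ler_pM ?exprn_ge0 ?invr_ge0 ?(ltW Q0) //.
  by rewrite ler_pXn2r ?nnegrE // mulr_ge0 // ltW.
by rewrite lef_pV2 ?posrE // mulr_gt0.
Qed.

End Sizes.

(** * Choice of the constants and passage to the limit *)

Theorem theorem1 (R : realType) (beta : R) (n_ m_ : nat -> nat) (p : nat -> R) :
  0 < beta ->
  (forall N : nat, \forall k \near \oo, (N <= n_ k)%N) ->
  (forall N : nat, \forall k \near \oo, (N <= m_ k)%N) ->
  (fun k => (m_ k)%:R / (n_ k)%:R : R) @ \oo --> beta ->
  (forall k, 0 <= p k) ->
  (fun N => \sum_(k < N) p k) @ \oo --> (1 : R) ->
  cvg ((fun N => \sum_(k < N) (k%:R * p k)) @ \oo) ->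
  ~ cvg ((fun N => \sum_(k < N) ((k ^ 2)%:R * p k)) @ \oo) ->
  forall eps : R, 0 < eps ->
    (fun k => prob_clust_gt p (n_ k) (m_ k) eps) @ \oo --> (0 : R).
Proof.
move=> beta0 n_oo m_oo mn_beta p0 p1 /cvg_ex[/= mu mean_p] sqr_dvg eps eps0.
have sqr_ge0 k : 0 <= (k ^ 2)%:R * p k by rewrite mulr_ge0.
have sqr_pinfty := nondecreasing_dvgn_lt (partial_sum_nondecreasing _ sqr_ge0) sqr_dvg.
(* Otherwise Z = 0 almost surely, and the second moment converges. *)
have [k k0 pk0] : exists2 k, (0 < k)%N & 0 < p k.
  apply: contrapT => nk; apply: sqr_dvg.
  rewrite (_ : (fun N => _) = fun=> 0); first exact: is_cvg_cst.
  apply/funext => N; rewrite big1 // => -[[|i] iN] _ /=; first by rewrite mul0r.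
  have [->|pi] := eqVneq (p i.+1) 0; first by rewrite mulr0.
  by case: nk; exists i.+1 => //; rewrite lt_neqAle eq_sym pi p0.
apply/cvgrPdist_lt => d0 d0_gt0.
(* Of the six terms in the bound, five will be at most d and the last at most 2 d: 7 d in all,
   strictly below [d0]. *)
pose d := d0 / 8; have d_gt0 : 0 < d by rewrite divr_gt0.
(* Eventually beta n / 2 <= m <= 2 beta n, so that 4 c m <= n p_k / 2 and n <= b m. *)
pose c := p k / (16 * beta); pose b := 2 / beta.
have c_gt0 : 0 < c by rewrite divr_gt0 // mulr_gt0.
have b_gt0 : 0 < b by rewrite divr_gt0.
have mu_ge0 : 0 <= mu.
  have := partial_sum_le _ _ 0 (fun i => mulr_ge0 (ler0n R i) (p0 i)) mean_p.
  by rewrite big_ord0.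
pose C := (mu + 1) / d; have C_gt0 : 0 < C by rewrite divr_gt0 // ltr_wpDl.
pose A := 24 / (eps * c ^+ 2) * b ^+ 2.
have A_gt0 : 0 < A by rewrite !(mulr_gt0, invr_gt0, exprn_gt0).
(* Gives A eta <= d and eta <= 1, hence A eta^2 <= d. *)
pose eta := d / (A + d).
have eta_gt0 : 0 < eta by rewrite divr_gt0 // addr_gt0.
have eta_le1 : eta <= 1 by rewrite ler_pdivrMr ?mul1r ?lerDr ?addr_gt0 // ltW.
have [T [cT2 cTd tailT]] : exists T : nat,
    [/\ 2 <= c * T%:R, 4 / d <= c * T%:R & mu - \sum_(i < T.+1) (i%:R * p i) <= eta * d].
  near \oo => T; exists T; split.
  - by rewrite [leRHS]mulrC -ler_pdivrMr //; near: T; apply: nbhs_infty_ger.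
  - by rewrite [leRHS]mulrC -ler_pdivrMr //; near: T; apply: nbhs_infty_ger.
  - rewrite lerBlDl -lerBlDr big_ord_recr /= ler_wpDr ?mulr_ge0 //; near: T.
    apply: (cvgr_ge _ mean_p).
    by rewrite gtrBl mulr_gt0.
(* Makes A T C^3 / M at most d, the 1 ensuring M > 0. As M depends on T, the cutoff L comes last. *)
pose M := A * (T%:R * C ^+ 3) / d + 1.
have TC_ge0 : 0 <= T%:R * C ^+ 3 := mulr_ge0 (ler0n _ _) (exprn_ge0 3 (ltW C_gt0)).
have M_gt0 : 0 < M.
  exact: ltr_wpDl (divr_ge0 (mulr_ge0 (ltW A_gt0) TC_ge0) (ltW d_gt0)) ltr01.
have [L L_M] : exists L : nat,
    2 * M <= \sum_(i < L.+1) p i * (i%:R ^+ 2 * (T < i)%N%:R).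
  near \oo => L; exists L.
  have TL : (T < L.+1)%N by rewrite ltnS; near: L; apply: nbhs_infty_ge.
  (* The terms up to T are a fixed amount, so divergence of the second moment supplies 2 M beyond
     T. *)
  have : 2 * M + \sum_(i < T.+1) ((i ^ 2)%:R * p i) <= \sum_(i < L.+1) ((i ^ 2)%:R * p i).
    rewrite [leRHS]big_ord_recr /= ler_wpDr //; near: L.
    by move/cvgryPge: sqr_pinfty; apply.
  rewrite (sum_ord_cat (fun i => (i ^ 2)%:R * p i) _ _ TL) addrC lerD2l => /le_trans; apply.
  rewrite (sum_ord_cat (fun i => p i * (i%:R ^+ 2 * (T < i)%N%:R)) _ _ TL) ler_wpDl //.
    by apply: sumr_ge0 => i _; rewrite !mulr_ge0 ?exprn_ge0.
  rewrite big_nat [leRHS]big_nat; apply: ler_sum => i /andP[-> _].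
  by rewrite mulr1 natrX mulrC.
have natr_ge (u : nat -> nat) : (forall N : nat, \forall i \near \oo, (N <= u i)%N) ->
    forall a : R, \forall i \near \oo, a <= (u i)%:R.
  move=> u_oo a; have [N _ aN] := nbhs_infty_ger a.
  by apply: filterS (u_oo N) => i Ni; apply: (le_trans (aN N (leqnn N))); rewrite ler_nat.
near=> j.
have n_gt0 : (0 < n_ j)%N by near: j; apply: n_oo.
have nR : 0 < (n_ j)%:R :> R by rewrite ltr0n.
have Tm : (T < m_ j)%N by near: j; apply: m_oo.
have km : (k < m_ j)%N by near: j; apply: m_oo.
have Lm : (L < m_ j)%N by near: j; apply: m_oo.
have mR : 0 < (m_ j)%:R :> R by rewrite ltr0n; apply: leq_trans Tm.
have nb : (n_ j)%:R <= b * (m_ j)%:R.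
  have : beta / 2 <= (m_ j)%:R / (n_ j)%:R.
    by near: j; apply: (cvgr_ge _ mn_beta); rewrite ltr_pdivrMr // ltr_pMr // ltr1n.
  rewrite ler_pdivlMr // => n_le; rewrite /b mulrAC ler_pdivlMr //; lra.
have pk : 2 * (2 * c * (m_ j)%:R + 1) <= (n_ j)%:R * p k.
  have : (m_ j)%:R / (n_ j)%:R <= 2 * beta.
    by near: j; apply: (cvgr_le _ mn_beta); rewrite ltr_pMl // ltr1n.
  rewrite ler_pdivrMr // => m_le.
  have : 4 / p k <= (n_ j)%:R by near: j; apply: natr_ge.
  rewrite ler_pdivrMr // => n_ge.
  have : c * (m_ j)%:R <= c * (2 * beta * (n_ j)%:R) by rewrite ler_pM2l.
  have -> : c * (2 * beta * (n_ j)%:R) = (n_ j)%:R * p k / 8.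
    by rewrite /c; field; rewrite gt_eqF.
  by rewrite -mulrA; lra.
have few_le : 2 / (2 * c * (m_ j)%:R + 1) <= d.
  have : (c * d)^-1 <= (m_ j)%:R by near: j; apply: natr_ge.
  rewrite -[_^-1]mul1r ler_pdivrMr ?(mulr_gt0 c_gt0 d_gt0) // => m_ge.
  have cm := mulr_gt0 c_gt0 mR.
  rewrite ler_pdivrMr; last by rewrite -mulrA; lra.
  have -> : d * (2 * c * (m_ j)%:R + 1) = 2 * ((m_ j)%:R * (c * d)) + d by ring.
  by lra.
have sqr_le : 2 * L%:R ^+ 2 / (M * (n_ j)%:R) <= d.
  have : 2 * L%:R ^+ 2 / (d * M) <= (n_ j)%:R by near: j; apply: natr_ge.
  rewrite ler_pdivrMr ?(mulr_gt0 d_gt0 M_gt0) // => L_le.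
  by rewrite ler_pdivrMr ?(mulr_gt0 M_gt0 nR) // [leRHS]mulrA [leRHS]mulrC.
have C_le : mu / C <= d.
  rewrite ler_pdivrMr // /C [d * _]mulrC divfK ?gt_eqF //; lra.
have tail_le : (mu - \sum_(i < T.+1) (i%:R * p i)) / eta <= d.
  by rewrite ler_pdivrMr // mulrC.
have cT_le : 4 / (c * T%:R) <= d.
  have cT0 : 0 < c * T%:R by apply: lt_le_trans cT2.
  by move: cTd; rewrite !ler_pdivrMr // mulrC.
have last_le : A * (T%:R * C ^+ 3 / M + eta ^+ 2) <= d + d.
  rewrite mulrDr lerD //.
    have dM : d * M = A * (T%:R * C ^+ 3) + d.
      by rewrite /M mulrDr mulr1 mulrCA mulfV ?mulr1 // gt_eqF.
    by rewrite mulrA ler_pdivrMr // dM lerDl ltW.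
  apply: (@le_trans _ _ (A * eta)).
    by rewrite ler_pM2l // expr2 ler_piMr // ltW.
  by rewrite /eta mulrA ler_pdivrMr ?addr_gt0 // mulrC ler_pM2l // lerDl ltW.
have := prob_clust_gt_le p mu p0 p1 mean_p (n_ j) (m_ j) T k L b c eps C eta M
  c_gt0 eps0 C_gt0 eta_gt0 M_gt0 n_gt0 k0 Tm km Lm cT2 nb pk L_M.
rewrite [24 / _ * _]mulrA -/A => prob_le.
rewrite sub0r normrN ger0_norm; last first.
  apply: sumr_ge0 => S _; apply: prodr_ge0 => v _.
  by rewrite divr_ge0 //; apply: Pmin_ge0.
have d8 : d0 = 8 * d by rewrite /d; field.
by lra.
Unshelve. all: by end_near.
Qed.
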